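(* For every weak rectangulation $\mathcal{R}$ we have $\tau(\mathcal{R})=\Theta(\beta(\mathcal{R}))$.
   Context: A rectangulation of an axis-aligned rectangle $R$ is a decomposition of $R$ into finitely many interior-disjoint axis-aligned rectangles; its size $n$ is the number of rectangles. A segment is a maximal straight line segment which is a union of sides of rectangles and is not contained in the boundary of $R$; rectangulations are generic (no two segments cross). For rectangles $X,Y$: $Y$ is right of $X$ ($X$ is left of $Y$) if there is a sequence $X=X_1,\dots,X_k=Y$ such that for every $i$ there is a vertical segment containing the right side of $X_i$ and the left side of $X_{i+1}$; $Y$ is above $X$ ($X$ below $Y$) analogously with horizontal segments containing the top side of $X_i$ and the bottom side of $X_{i+1}$. Every pair of distinct rectangles satisfies exactly one of these four relations. Two rectangulations are weakly equivalent if there is a bijection between their rectangles preserving these relations; a weak rectangulation is an equivalence class. The SE–NW ordering is the linear order with $X\prec Y$ iff $X$ is right of or below $Y$; the SW–NE ordering is the linear order with $X\prec Y$ iff $X$ is left of or below $Y$. $\beta(\mathcal{R})=\pi_1\cdots\pi_n$ where $\pi_j$ is the position in the SE–NW ordering of the $j$-th rectangle in the SW–NE ordering. $\tau(\mathcal{R})=(e_1,\dots,e_n)$ where $e_j$ is the number of rectangles that are left of the $j$-th rectangle in the SW–NE ordering. For a permutation $\pi\in S_n$, $\Theta(\pi)=(e_1,\dots,e_n)$ with $e_k=|\{i: 1\le i<k,\ \pi_i>\pi_k\}|$. *)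

(* Defs.v *)
From HB Require Import structures.
From mathcomp Require Import all_boot all_order all_algebra all_fingroup.
From mathcomp Require Import boolp classical_sets set_interval reals.

Set Implicit Arguments.
Unset Strict Implicit.
Unset Printing Implicit Defensive.

Import Order.TTheory GRing.Theory Num.Theory.

Local Open Scope classical_set_scope.
Local Open Scope ring_scope.

Section Boxes.
Variable R : realType.

Record box := Box {
  xmin : R; xmax : R; ymin : R; ymax : R;
  box_wd : xmin < xmax; box_ht : ymin < ymax }.

Definition box_set (B : box) : set (R * R) :=
  `[xmin B, xmax B] `*` `[ymin B, ymax B].

Definition box_int (B : box) : set (R * R) :=
  `]xmin B, xmax B[ `*` `]ymin B, ymax B[.

Definition box_bd (B : box) : set (R * R) := box_set B `\` box_int B.

Definition vseg (x a b : R) : set (R * R) := [set x] `*` `[a, b].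
Definition hseg (y a b : R) : set (R * R) := `[a, b] `*` [set y].

Definition left_side (B : box) := vseg (xmin B) (ymin B) (ymax B).
Definition right_side (B : box) := vseg (xmax B) (ymin B) (ymax B).
Definition bottom_side (B : box) := hseg (ymin B) (xmin B) (xmax B).
Definition top_side (B : box) := hseg (ymax B) (xmin B) (xmax B).

Definition vertical (L : set (R * R)) := exists x a b, a < b /\ L = vseg x a b.
Definition horizontal (L : set (R * R)) :=
  exists y a b, a < b /\ L = hseg y a b.

(* The two lines meet at a point in the relative interior of both. *)
Definition cross (L M : set (R * R)) := exists x a b y c d,
  [/\ L = vseg x a b, M = hseg y c d, a < y < b & c < x < d].

End Boxes.

Section Rectangulations.
Variables (R : realType) (n : nat).

(* A decomposition of the box D into the n boxes B i, the labels i : 'I_n      *)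
(* carrying no order information. Genericity is imposed separately below.     *)
Definition decomposition (D : box R) (B : 'I_n -> box R) :=
  \bigcup_i box_set (B i) = box_set D /\
  (forall i j, i != j -> box_int (B i) `&` box_int (B j) = set0).

Definition sides (B : 'I_n -> box R) : set (set (R * R)) :=
  [set s | exists i, [\/ s = left_side (B i), s = right_side (B i),
                         s = bottom_side (B i) | s = top_side (B i)]].

(* A straight line segment that is a union of sides is parallel to an axis,   *)
(* so only axis-parallel ones need be considered.                             *)
Definition inner_line (D : box R) (B : 'I_n -> box R) (L : set (R * R)) :=
  [/\ vertical L \/ horizontal L,
      exists2 F, F `<=` sides B & L = \bigcup_(s in F) s
    & ~ L `<=` box_bd D].

Definition segment (D : box R) (B : 'I_n -> box R) (L : set (R * R)) :=
  inner_line D B L /\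
  (forall M, inner_line D B M -> L `<=` M -> M = L).

Record rectangulation := Rectangulation {
  outer : box R;
  rect : 'I_n -> box R;
  rect_dec : decomposition outer rect;
  rect_generic : forall L M,
    segment outer rect L -> segment outer rect M -> ~ cross L M }.

Section Relations.
Variable S : rectangulation.

Definition vstep : rel 'I_n := fun X Y =>
  `[< exists L, [/\ segment (outer S) (rect S) L, vertical L,
        right_side (rect S X) `<=` L & left_side (rect S Y) `<=` L] >].

Definition hstep : rel 'I_n := fun X Y =>
  `[< exists L, [/\ segment (outer S) (rect S) L, horizontal L,
        top_side (rect S X) `<=` L & bottom_side (rect S Y) `<=` L] >].

(* The relations hold between distinct rectangles only: the one-term chain    *)
(* from X to itself is discarded.                                             *)
Definition left_of : rel 'I_n := fun X Y => (X != Y) && connect vstep X Y.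
Definition right_of : rel 'I_n := fun X Y => left_of Y X.
Definition below : rel 'I_n := fun X Y => (X != Y) && connect hstep X Y.
Definition above : rel 'I_n := fun X Y => below Y X.

Definition swne : rel 'I_n := fun X Y => left_of X Y || below X Y.
Definition senw : rel 'I_n := fun X Y => right_of X Y || below X Y.

(* The rectangles listed increasingly for a strict linear order r (sort works *)
(* with the associated reflexive order).                                      *)
Definition listing (r : rel 'I_n) : seq 'I_n :=
  sort (fun X Y => (X == Y) || r X Y) (enum 'I_n).

Lemma size_listing r : size (listing r) = n.
Proof. by rewrite size_sort size_enum_ord. Qed.

Lemma uniq_listing r : uniq (listing r).
Proof. by rewrite sort_uniq enum_uniq. Qed.

Lemma mem_listing r X : X \in listing r.
Proof. by rewrite mem_sort mem_enum. Qed.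

(* Indices, positions and permutation values all start from 0.                *)
Definition rect_at (r : rel 'I_n) (j : 'I_n) : 'I_n := nth j (listing r) j.

Lemma position_subproof r X : (index X (listing r) < n)%N.
Proof. by rewrite -[X in (_ < X)%N](size_listing r) index_mem mem_listing. Qed.

Definition position (r : rel 'I_n) (X : 'I_n) : 'I_n :=
  Ordinal (position_subproof r X).

Lemma beta_subproof : injective (fun j => position senw (rect_at swne j)).
Proof.
move=> j k [] /(congr1 (nth j (listing senw))).
rewrite !nth_index ?mem_listing // /rect_at.
rewrite (set_nth_default j k) ?size_listing // => /eqP.
by rewrite nth_uniq ?size_listing ?uniq_listing // => /eqP/val_inj.
Qed.

Definition beta : 'S_n := perm beta_subproof.

Definition tau : n.-tuple nat :=
  [tuple #|[set X | left_of X (rect_at swne j)]%SET| | j < n].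

End Relations.

Definition weakly_equivalent (S T : rectangulation) :=
  exists2 f : 'I_n -> 'I_n, bijective f &
    forall X Y, [/\ left_of T (f X) (f Y) = left_of S X Y,
                    right_of T (f X) (f Y) = right_of S X Y,
                    below T (f X) (f Y) = below S X Y
                  & above T (f X) (f Y) = above S X Y].

(* tau and beta of a class are those of any of its members.                   *)
Record weak_rectangulation := WeakRectangulation {
  members :> set rectangulation;
  members_class : exists S, members = [set T | weakly_equivalent S T] }.

Definition Theta (p : 'S_n) : n.-tuple nat :=
  [tuple #|[set i : 'I_n | (i < k)%N && (p k < p i)%N]%SET| | k < n].

End Rectangulations.

(* Main.v *)
(* The geometric content is that any two boxes X, Y satisfy exactly one of    *)
(* the four relations; then swne and senw are strict linear orders, X         *)
(* precedes Y in swne and follows it in senw iff X is left of Y, and counting *)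
(* such X for fixed Y gives both sides.                                       *)
(*                                                                            *)
(* At least one relation: if X, Y are not related by left/right, let N be the *)
(* set of boxes that have X or Y on their left. At each height let the cut    *)
(* box be the last one outside N; X and Y are cut boxes, and when the height  *)
(* increases two successive cut boxes have a common horizontal segment        *)
(* between them, so that the lower one of X, Y is below the other one.        *)
(*                                                                            *)
(* At most one: if X is left of Y, a chain of boxes through X and Y joins the *)
(* left side of the outer box to its right side. By genericity a horizontal   *)
(* segment never passes from one side of the chain to the other, hence going  *)
(* up from one box of the chain never leads to another one.                   *)

Require Import Defs.
From mathcomp Require Import all_boot all_order all_algebra all_fingroup.
From mathcomp Require Import boolp classical_sets set_interval reals.
From mathcomp Require Import lra.

Set Implicit Arguments.
Unset Strict Implicit.
Unset Printing Implicit Defensive.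

Import Order.TTheory GRing.Theory Num.Theory.

Local Open Scope classical_set_scope.
Local Open Scope ring_scope.

(** [X] is left of [Y] exactly when [X] precedes [Y] in [swne] and [Y] precedes [X] in [senw], so
    the boxes left of the [k]-th one correspond to the inversions of [beta] ending at [k]
    ([tau_Theta_beta]). This reading of positions requires [swne] and [senw] to be linear orders.
    Each is a union of two strict partial orders that exclude each other and together compare any
    two distinct boxes; such a union is transitive ([union_rel_trans]). Comparability is
    [left_or_below_total], obtained by climbing the cut boxes ([cut_connect]). Exclusion is
    [left_not_below], obtained from a chain spanning the outer box ([connect_not_below], resting on
    [path_above]). Passing to the class is [tau_weakly_equivalent]. *)

Section Boxes.
Variable R : realType.
Implicit Types (B C : box R) (x y a b c d : R) (L M : set (R * R)).

(** * Coordinates of boxes and axis-parallel segments *)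

Lemma box_setE B p : box_set B p =
  ((xmin B <= p.1 <= xmax B) && (ymin B <= p.2 <= ymax B)) :> Prop.
Proof.
rewrite /box_set /setX /= !in_itv /=; apply/propext.
by split=> [[-> ->]|/andP[]].
Qed.

Lemma box_intE B p : box_int B p =
  ((xmin B < p.1 < xmax B) && (ymin B < p.2 < ymax B)) :> Prop.
Proof.
rewrite /box_int /setX /= !in_itv /=; apply/propext.
by split=> [[-> ->]|/andP[]].
Qed.

Lemma vsegE x a b p : vseg x a b p = ((p.1 == x) && (a <= p.2 <= b)) :> Prop.
Proof.
rewrite /vseg /setX /= in_itv /=; apply/propext.
by split=> [[-> ->]|/andP[/eqP]] //; rewrite eqxx.
Qed.

Lemma hsegE y a b p : hseg y a b p = ((p.2 == y) && (a <= p.1 <= b)) :> Prop.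
Proof.
rewrite /hseg /setX /= in_itv /=; apply/propext.
by split=> [[-> ->]|/andP[/eqP]] //; rewrite eqxx.
Qed.

Lemma vseg_sub x a b x' a' b' : a <= b ->
  vseg x a b `<=` vseg x' a' b' -> [/\ x = x', a' <= a & b <= b'].
Proof.
move=> ab s; have := s (x, a); have := s (x, b); rewrite !vsegE /= eqxx !lexx ab.
by move=> /(_ isT)/and3P[/eqP-> _ ->] /(_ isT)/and3P[_ -> _].
Qed.

Lemma hseg_sub y a b y' a' b' : a <= b ->
  hseg y a b `<=` hseg y' a' b' -> [/\ y = y', a' <= a & b <= b'].
Proof.
move=> ab s; have := s (a, y); have := s (b, y); rewrite !hsegE /= eqxx !lexx ab.
by move=> /(_ isT)/and3P[/eqP-> _ ->] /(_ isT)/and3P[_ -> _].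
Qed.

Lemma vseg_not_sub_hseg x a b y c d : a < b -> ~ vseg x a b `<=` hseg y c d.
Proof.
move=> ab s; have := s (x, a); have := s (x, b); rewrite !vsegE !hsegE /=.
rewrite eqxx !lexx (ltW ab) => /(_ isT)/andP[/eqP yb _] /(_ isT)/andP[/eqP ya _].
by move: ab; rewrite ya yb ltxx.
Qed.

Lemma hseg_not_sub_vseg y c d x a b : c < d -> ~ hseg y c d `<=` vseg x a b.
Proof.
move=> cd s; have := s (c, y); have := s (d, y); rewrite !vsegE !hsegE /=.
rewrite eqxx !lexx (ltW cd) => /(_ isT)/andP[/eqP yb _] /(_ isT)/andP[/eqP ya _].
by move: cd; rewrite ya yb ltxx.
Qed.

Lemma vsegU x a b a' b' t : a <= t <= b -> a' <= t <= b' ->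
  vseg x a b `|` vseg x a' b' = vseg x (Num.min a a') (Num.max b b').
Proof.
move=> /andP[a1 a2] /andP[b1 b2]; apply/seteqP; split=> [[u v]|[u v]].
  case; rewrite !vsegE /= => /and3P[-> h1 h2] /=;
  by rewrite ge_min le_max h1 h2 ?orbT.
rewrite !vsegE /= => /and3P[/eqP-> h1 h2].
have [vt|tv] := leP v t.
  move: h1; rewrite ge_min => /orP[h|h]; [left|right]; rewrite vsegE /= eqxx /=; lra.
move: h2; rewrite le_max => /orP[h|h]; [left|right]; rewrite vsegE /= eqxx /=; lra.
Qed.

Lemma hsegU y a b a' b' t : a <= t <= b -> a' <= t <= b' ->
  hseg y a b `|` hseg y a' b' = hseg y (Num.min a a') (Num.max b b').
Proof.
move=> /andP[a1 a2] /andP[b1 b2]; apply/seteqP; split=> [[v u]|[v u]].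
  case; rewrite !hsegE /= => /and3P[-> h1 h2] /=;
  by rewrite ge_min le_max h1 h2 ?orbT.
rewrite !hsegE /= => /and3P[/eqP-> h1 h2].
have [vt|tv] := leP v t.
  move: h1; rewrite ge_min => /orP[h|h]; [left|right]; rewrite hsegE /= eqxx /=; lra.
move: h2; rewrite le_max => /orP[h|h]; [left|right]; rewrite hsegE /= eqxx /=; lra.
Qed.

Lemma exists_between a b c d : [&& a < c, a < d, b < c & b < d] ->
  exists x, [/\ a < x, b < x, x < c & x < d].
Proof.
move=> /and4P[ac ad bc bd]; exists ((Num.max a b + Num.min c d) / 2).
have : Num.max a b < Num.min c d by rewrite lt_min !gt_max ac ad bc bd.
have : a <= Num.max a b /\ b <= Num.max a b by rewrite !le_max !lexx orbT.
have : Num.min c d <= c /\ Num.min c d <= d by rewrite !ge_min !lexx orbT.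
by split; lra.
Qed.

Lemma right_gap (s : seq R) x m : x < m ->
  exists2 x', x < x' < m & {in s, forall z, x < z -> x' < z}.
Proof.
move=> xm; elim: s => [|z s [x' /andP[x1 x2] IH]].
  by exists ((x + m) / 2) => //; lra.
have [xz|zx] := ltP x z; last first.
  exists x'; first by rewrite x1.
  by move=> w; rewrite in_cons => /orP[/eqP->|/IH//]; rewrite ltNge zx.
exists ((x + Num.min x' z) / 2).
  have : x < Num.min x' z by rewrite lt_min x1.
  have : Num.min x' z <= x' by rewrite ge_min lexx.
  lra.
have h1 : x < Num.min x' z by rewrite lt_min x1.
have h2 : Num.min x' z <= x' by rewrite ge_min lexx.
have h3 : Num.min x' z <= z by rewrite ge_min lexx orbT.
move=> w; rewrite in_cons => /orP[/eqP-> _|/IH h /h]; lra.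
Qed.

End Boxes.

(** * The tiling and its maximal segments *)

Section Geometry.
Variables (R : realType) (n : nat) (S : rectangulation R n).
Implicit Types (X Y Z W : 'I_n) (L M : set (R * R)) (x y : R).
Local Notation D := (outer S).
Local Notation B := (rect S).
Local Notation vstep := (vstep S).
Local Notation hstep := (hstep S).

Lemma rect_sub_outer Z : [/\ xmin D <= xmin (B Z), xmax (B Z) <= xmax D,
  ymin D <= ymin (B Z) & ymax (B Z) <= ymax D].
Proof.
have [cov _] := rect_dec S.
have sub p : box_set (B Z) p -> box_set D p by rewrite -cov; exists Z.
have w := box_wd (B Z); have h := box_ht (B Z).
have := sub (xmin (B Z), ymin (B Z)); have := sub (xmax (B Z), ymax (B Z)).
rewrite !box_setE /= => h1 h2.
have /andP[/andP[? ?] /andP[? ?]] := h1 ltac:(lra).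
by have /andP[/andP[? ?] /andP[? ?]] := h2 ltac:(lra).
Qed.

Lemma rect_sep X Y : X != Y -> [\/ xmax (B X) <= xmin (B Y),
  xmax (B Y) <= xmin (B X), ymax (B X) <= ymin (B Y) | ymax (B Y) <= ymin (B X)].
Proof.
move=> XY; have [_ /(_ _ _ XY) dis] := rect_dec S.
have [?|h1] := leP (xmax (B X)) (xmin (B Y)); first by constructor 1.
have [?|h2] := leP (xmax (B Y)) (xmin (B X)); first by constructor 2.
have [?|h3] := leP (ymax (B X)) (ymin (B Y)); first by constructor 3.
have [?|h4] := leP (ymax (B Y)) (ymin (B X)); first by constructor 4.
have w := (box_wd (B X), box_ht (B X), box_wd (B Y), box_ht (B Y)).
have [|x [? ? ? ?]] :=
  @exists_between _ (xmin (B X)) (xmin (B Y)) (xmax (B X)) (xmax (B Y)).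
  by rewrite !w h1 h2.
have [|y [? ? ? ?]] :=
  @exists_between _ (ymin (B X)) (ymin (B Y)) (ymax (B X)) (ymax (B Y)).
  by rewrite !w h3 h4.
exfalso; suff : set0 (x, y) by [].
rewrite -dis; split; rewrite box_intE /=; lra.
Qed.

(** Push the point slightly right and up without reaching a further left or bottom boundary
    ([right_gap]): a closed box covering the new point covers the old one in the half-open sense. *)
Lemma rect_cover x y : xmin D <= x < xmax D -> ymin D <= y < ymax D ->
  exists Z, (xmin (B Z) <= x < xmax (B Z)) && (ymin (B Z) <= y < ymax (B Z)).
Proof.
move=> /andP[x1 x2] /andP[y1 y2].
have [x' hx' gx] := right_gap (codom (fun Z => xmin (B Z))) x2.
have [y' hy' gy] := right_gap (codom (fun Z => ymin (B Z))) y2.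
have [cov _] := rect_dec S.
have : box_set D (x', y') by rewrite box_setE /=; lra.
rewrite -cov => -[Z _]; rewrite box_setE /= => hZ; exists Z.
have gxZ : x < xmin (B Z) -> x' < xmin (B Z) by apply: gx; exact: codom_f.
have gyZ : y < ymin (B Z) -> y' < ymin (B Z) by apply: gy; exact: codom_f.
have [h|h] := ltP x (xmin (B Z)); first by have := gxZ h; lra.
have [k|k] := ltP y (ymin (B Z)); first by have := gyZ k; lra.
lra.
Qed.

(** Indexing the sides by a finite type lets maximal segments be found among finitely many sets of
    indices. *)
Definition side (k : 'I_n * bool * bool) : set (R * R) :=
  match k with
  | (i, true, true) => left_side (B i)
  | (i, true, false) => right_side (B i)
  | (i, false, true) => bottom_side (B i)
  | (i, false, false) => top_side (B i)
  end.

Lemma sidesP s : sides B s <-> exists k, s = side k.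
Proof.
split=> [[i [] ->]|[[[i []] []] ->]].
- by exists (i, true, true).
- by exists (i, true, false).
- by exists (i, false, true).
- by exists (i, false, false).
- by exists i; constructor 1.
- by exists i; constructor 2.
- by exists i; constructor 3.
- by exists i; constructor 4.
Qed.

(** An inner line is the union of the sides it contains, so a maximal index set whose union is an
    inner line containing [L] gives a segment. *)
Lemma segment_exists L : inner_line D B L ->
  exists2 M, segment D B M & L `<=` M.
Proof.
move=> iL; pose U (A : {set 'I_n * bool * bool}) : set (R * R) :=
  \bigcup_(k in [set k | k \in A]) side k.
pose inside M := [set k | `[< side k `<=` M >]]%SET.
have insideU M : inner_line D B M -> U (inside M) = M.
  move=> [_ [F FS ->] _]; apply/seteqP; split=> [p [k /=]|p [s Fs sp]].
    by rewrite inE => /asboolP; apply.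
  have /sidesP[k sk] := FS _ Fs; exists k; last by rewrite -sk.
  by rewrite /= inE; apply/asboolP => q kq; exists s => //; rewrite sk.
pose P A := `[< inner_line D B (U A) /\ L `<=` U A >].
have PL : P (inside L) by apply/asboolP; rewrite insideU //; split.
have [A /maxsetP[/asboolP[iA LA] maxA] _] := maxset_exists PL.
exists (U A) => //; split=> // M iM AM.
have sub : A \subset inside M.
  apply/fintype.subsetP => k kA; rewrite inE; apply/asboolP => p kp.
  by apply: AM; exists k.
rewrite -(insideU M iM) (maxA (inside M)) //.
by apply/asboolP; rewrite insideU //; split=> // p /LA /AM.
Qed.

Lemma side_right Z : sides B (right_side (B Z)).
Proof. by exists Z; constructor 2. Qed.

Lemma side_left Z : sides B (left_side (B Z)).
Proof. by exists Z; constructor 1. Qed.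

Lemma side_top Z : sides B (top_side (B Z)).
Proof. by exists Z; constructor 4. Qed.

Lemma side_bottom Z : sides B (bottom_side (B Z)).
Proof. by exists Z; constructor 3. Qed.

Lemma segment_max L M : segment D B L -> (vertical (L `|` M) \/ horizontal (L `|` M)) ->
  sides B M -> M `<=` L.
Proof.
move=> [[_ [F FS eL] nb] mx] vh sM; rewrite -[X in _ `<=` X](mx (L `|` M)) //.
split=> //; last by move=> h; apply: nb => p Lp; apply: h; left.
exists (F `|` [set M]); first by move=> s [/FS//|->].
by rewrite bigcup_setU bigcup_set1 -eL.
Qed.

(** A collinear side meeting the segment, here at [t], would extend it, so maximality forces the
    side inside. *)
Lemma segment_absorb_v L x a b a' b' t : segment D B L -> L = vseg x a b ->
  sides B (vseg x a' b') -> a' <= t <= b' -> a <= t <= b -> a <= a' /\ b' <= b.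
Proof.
move=> sL eL sM h1 h2; have hab : a' <= b' by lra.
suff : vseg x a' b' `<=` L by rewrite eL => /(vseg_sub hab)[].
have [[[[x' [c [d [cd eL']]]]|[y' [c [d [cd eL']]]]] _ _] _] := sL; last first.
  exfalso; apply: (@hseg_not_sub_vseg _ y' c d x a b) => //.
  by rewrite -eL' eL.
have {eL' x' c d cd} ab : a < b.
  have : vseg x' c d `<=` vseg x a b by rewrite -eL' eL.
  by move=> /(vseg_sub (ltW cd)) [_]; lra.
apply: segment_max => //; left.
exists x, (Num.min a a'), (Num.max b b'); split.
  by rewrite gt_min !lt_max ab.
by rewrite eL (vsegU _ h2 h1).
Qed.

Lemma segment_absorb_h L x a b a' b' t : segment D B L -> L = hseg x a b ->
  sides B (hseg x a' b') -> a' <= t <= b' -> a <= t <= b -> a <= a' /\ b' <= b.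
Proof.
move=> sL eL sM h1 h2; have hab : a' <= b' by lra.
suff : hseg x a' b' `<=` L by rewrite eL => /(hseg_sub hab)[].
have [[[[y' [c [d [cd eL']]]]|[x' [c [d [cd eL']]]]] _ _] _] := sL.
  exfalso; apply: (@vseg_not_sub_hseg _ y' c d x a b) => //.
  by rewrite -eL' eL.
have {eL' x' c d cd} ab : a < b.
  have : hseg x' c d `<=` hseg x a b by rewrite -eL' eL.
  by move=> /(hseg_sub (ltW cd)) [_]; lra.
apply: segment_max => //; right.
exists x, (Num.min a a'), (Num.max b b'); split.
  by rewrite gt_min !lt_max ab.
by rewrite eL (hsegU _ h2 h1).
Qed.

Lemma vstepP X Y : reflect (exists L a b, [/\ segment D B L,
    L = vseg (xmax (B X)) a b, xmax (B X) = xmin (B Y),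
    a <= ymin (B X) /\ ymax (B X) <= b & a <= ymin (B Y) /\ ymax (B Y) <= b])
  (vstep X Y).
Proof.
apply: (iffP (asboolP _)) => [[L [sL [x [a [b [ab eL]]]]]]|
  [L [a [b [sL eL exy [a1 a2] [a3 a4]]]]]].
  rewrite eL => /(vseg_sub (ltW (box_ht _)))[ex h1 h2].
  move=> /(vseg_sub (ltW (box_ht _)))[ey h3 h4].
  by exists L, a, b; split; rewrite // ?ex ?ey.
have h := box_ht (B X).
exists L; split=> //; first by exists (xmax (B X)), a, b; split=> //; lra.
  by move=> p; rewrite eL /right_side !vsegE => /andP[-> /=]; lra.
by move=> p; rewrite eL /left_side !vsegE exy => /andP[-> /=]; lra.
Qed.

Lemma hstepP X Y : reflect (exists L a b, [/\ segment D B L,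
    L = hseg (ymax (B X)) a b, ymax (B X) = ymin (B Y),
    a <= xmin (B X) /\ xmax (B X) <= b & a <= xmin (B Y) /\ xmax (B Y) <= b])
  (hstep X Y).
Proof.
apply: (iffP (asboolP _)) => [[L [sL [x [a [b [ab eL]]]]]]|
  [L [a [b [sL eL exy [a1 a2] [a3 a4]]]]]].
  rewrite eL => /(hseg_sub (ltW (box_wd _)))[ex h1 h2].
  move=> /(hseg_sub (ltW (box_wd _)))[ey h3 h4].
  by exists L, a, b; split; rewrite // ?ex ?ey.
have h := box_wd (B X).
exists L; split=> //; first by exists (ymax (B X)), a, b; split=> //; lra.
  by move=> p; rewrite eL /top_side !hsegE => /andP[-> /=]; lra.
by move=> p; rewrite eL /bottom_side !hsegE exy => /andP[-> /=]; lra.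
Qed.

Lemma vside_segment x a b : a < b -> sides B (vseg x a b) ->
  xmin D < x < xmax D -> ymin D <= a -> b <= ymax D ->
  exists L a' b', [/\ segment D B L, L = vseg x a' b', a' <= a & b <= b'].
Proof.
move=> ab sM h1 h2 h3; have iM : inner_line D B (vseg x a b).
  split; first by left; exists x, a, b.
    by exists [set vseg x a b]; rewrite ?bigcup_set1 // => s ->.
  (* The midpoint is interior to [D], so the side is not contained in the boundary. *)
  move=> /(_ (x, (a + b) / 2)); rewrite vsegE /= => -[]; first lra.
  by move=> _; apply; rewrite box_intE /=; lra.
have [L sL] := segment_exists iM.
have [[[[x' [c [d [cd eL]]]]|[y' [c [d [cd eL]]]]] _ _] _] := sL; rewrite eL; last first.
  by move/vseg_not_sub_hseg => /(_ ab).
by move=> /(vseg_sub (ltW ab))[-> ? ?]; exists L, c, d; rewrite -eL.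
Qed.

Lemma hside_segment y a b : a < b -> sides B (hseg y a b) ->
  ymin D < y < ymax D -> xmin D <= a -> b <= xmax D ->
  exists L a' b', [/\ segment D B L, L = hseg y a' b', a' <= a & b <= b'].
Proof.
move=> ab sM h1 h2 h3; have iM : inner_line D B (hseg y a b).
  split; first by right; exists y, a, b.
    by exists [set hseg y a b]; rewrite ?bigcup_set1 // => s ->.
  move=> /(_ ((a + b) / 2, y)); rewrite hsegE /= => -[]; first lra.
  by move=> _; apply; rewrite box_intE /=; lra.
have [L sL] := segment_exists iM.
have [[[[y' [c [d [cd eL]]]]|[x' [c [d [cd eL]]]]] _ _] _] := sL; rewrite eL.
  by move/hseg_not_sub_vseg => /(_ ab).
by move=> /(hseg_sub (ltW ab))[-> ? ?]; exists L, c, d; rewrite -eL.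
Qed.

(** * Adjacent boxes and walks at a fixed height *)

Definition hadj X Y := xmax (B X) = xmin (B Y) /\
  ymin (B X) < ymax (B Y) /\ ymin (B Y) < ymax (B X).

Lemma right_side_segment X : xmax (B X) < xmax D -> exists L a b, [/\ segment D B L,
   L = vseg (xmax (B X)) a b, a <= ymin (B X) /\ ymax (B X) <= b &
   forall Y, hadj X Y -> a <= ymin (B Y) /\ ymax (B Y) <= b].
Proof.
move=> hX; have [d1 d2 d3 d4] := rect_sub_outer X; have w := box_wd (B X).
have [|//|//|L [a [b [sL eL h1 h2]]]] :=
  vside_segment (box_ht (B X)) (side_right X); first lra.
exists L, a, b; split=> // Y [exy [o1 o2]].
have := side_left Y; rewrite /left_side -exy => sY.
have w1 := box_ht (B X); have w2 := box_ht (B Y).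
have [h|h] := leP (ymin (B X)) (ymin (B Y)).
  by apply: (segment_absorb_v (t := ymin (B Y)) sL eL sY); lra.
by apply: (segment_absorb_v (t := ymin (B X)) sL eL sY); lra.
Qed.

Lemma hadj_vstep X Y : hadj X Y -> vstep X Y.
Proof.
move=> a; have [exy _] := a.
have [_ d _ _] := rect_sub_outer Y; have w := box_wd (B Y).
have [|L [p [q [sL eL h1 h2]]]] := @right_side_segment X; first lra.
by apply/vstepP; exists L, p, q; split=> //; apply: h2.
Qed.

(** The segment behind the step to [Y] absorbs the right side of [X], and through it the left side
    of [Z]. *)
Lemma vstep_right W X Y Z : vstep W Y -> hadj X Y -> hadj X Z -> vstep W Z.
Proof.
move=> /vstepP[L [a [b [sL eL ewy [h1 h2] [h3 h4]]]]] [exy [o1 o2]] [exz [o3 o4]].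
have := (side_right X, side_left Z); rewrite /right_side /left_side -exz.
have -> : xmax (B X) = xmax (B W) by rewrite ewy.
move=> [sX sZ]; have hX := box_ht (B X); have hY := box_ht (B Y); have hZ := box_ht (B Z).
have [k1 k2] : a <= ymin (B X) /\ ymax (B X) <= b.
  have [h|h] := leP (ymin (B X)) (ymin (B Y)).
    by apply: (segment_absorb_v (t := ymin (B Y)) sL eL sX); lra.
  by apply: (segment_absorb_v (t := ymin (B X)) sL eL sX); lra.
apply/vstepP; exists L, a, b; split=> //; first by rewrite -exz exy.
have [h|h] := leP (ymin (B X)) (ymin (B Z)).
  by apply: (segment_absorb_v (t := ymin (B Z)) sL eL sZ); lra.
by apply: (segment_absorb_v (t := ymin (B X)) sL eL sZ); lra.
Qed.

(** Half-open, so that at the height of a top side the box resting on it counts and the box under it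
    does not. *)
Definition at_height y Z := ymin (B Z) <= y < ymax (B Z).

Lemma right_neighbour y X : at_height y X -> xmax (B X) < xmax D ->
  exists2 Z, at_height y Z & xmin (B Z) = xmax (B X).
Proof.
rewrite /at_height => yX hX; have [d1 d2 d3 d4] := rect_sub_outer X; have w := box_wd (B X).
have [||Z /andP[hx hy]] := @rect_cover (xmax (B X)) y; try lra.
exists Z => //; have XZ : X != Z by apply/eqP => e; move: hx; rewrite -e; lra.
by have [] := rect_sep XZ; lra.
Qed.

Lemma at_height_sep y X Y : at_height y X -> at_height y Y -> X != Y ->
  xmax (B X) <= xmin (B Y) \/ xmax (B Y) <= xmin (B X).
Proof. by rewrite /at_height => h1 h2 /rect_sep[]; lra. Qed.

Lemma at_height_hadj y X Y : at_height y X -> at_height y Y ->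
  xmax (B X) = xmin (B Y) -> hadj X Y.
Proof. by rewrite /at_height => h1 h2; split=> //; lra. Qed.

(** Repeatedly take the right neighbour at height [y]; the number of boxes starting further right
    decreases. The first neighbour [Z] is exposed because for a cut box it is the first one known to
    lie in [N]. *)
Lemma walk_right y X Y : at_height y X -> at_height y Y -> xmax (B X) <= xmin (B Y) ->
  exists Z, [/\ hadj X Z, at_height y Z & connect vstep Z Y].
Proof.
have [m] := ubnP #|[set Z | xmin (B X) < xmin (B Z)]%SET|.
elim: m X => // m IH X hm yX yY XY.
have [_ d _ _] := rect_sub_outer Y; have w := box_wd (B Y).
have [|Z yZ eZ] := right_neighbour yX; first lra.
have XZ := at_height_hadj yX yZ (esym eZ).
have [<-|ZY] := eqVneq Z Y; first by exists Z; split.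
have wZ := box_wd (B Z); have wX := box_wd (B X).
have [h|h] := at_height_sep yZ yY ZY; last lra.
have [|T [ZT _ TY]] := IH Z _ yZ yY h; last first.
  exists Z; split=> //; apply: connect_trans TY; exact/connect1/hadj_vstep.
rewrite ltnS in hm; apply: leq_trans hm; apply: proper_card; apply/properP; split.
  by apply/fintype.subsetP => T; rewrite !inE; lra.
by exists Z; rewrite !inE ?ltxx //; lra.
Qed.

Lemma connect_vstep_le X Y : connect vstep X Y -> X = Y \/ xmax (B X) <= xmin (B Y).
Proof.
move=> /connectP[s sp ->]; elim: s X sp => [|Z s IH] X /=; first by left.
move=> /andP[/vstepP[L [a [b [_ _ e _ _]]]] /IH h]; right; rewrite e.
have w := box_wd (B Z).
by case: h => [<-//|]; lra.
Qed.

Lemma connect_hstep_le X Y : connect hstep X Y -> X = Y \/ ymax (B X) <= ymin (B Y).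
Proof.
move=> /connectP[s sp ->]; elim: s X sp => [|Z s IH] X /=; first by left.
move=> /andP[/hstepP[L [a [b [_ _ e _ _]]]] /IH h]; right; rewrite e.
have w := box_ht (B Z).
by case: h => [<-//|]; lra.
Qed.

Lemma left_of_le X Y : left_of S X Y -> xmax (B X) <= xmin (B Y).
Proof. by move=> /andP[/eqP XY /connect_vstep_le[]]. Qed.

Lemma below_le X Y : below S X Y -> ymax (B X) <= ymin (B Y).
Proof. by move=> /andP[/eqP XY /connect_hstep_le[]]. Qed.

Lemma left_of_trans : transitive (left_of S).
Proof.
move=> Y X Z XY YZ; have := (left_of_le XY, left_of_le YZ, box_wd (B X), box_wd (B Y)).
move=> [[[h1 h2] h3] h4]; move: XY YZ => /andP[_ XY] /andP[_ YZ].
rewrite /left_of (connect_trans XY YZ) andbT; apply/eqP => e.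
by move: h1 h3; rewrite e; lra.
Qed.

Lemma below_trans : transitive (below S).
Proof.
move=> Y X Z XY YZ; have := (below_le XY, below_le YZ, box_ht (B X), box_ht (B Y)).
move=> [[[h1 h2] h3] h4]; move: XY YZ => /andP[_ XY] /andP[_ YZ].
rewrite /below (connect_trans XY YZ) andbT; apply/eqP => e.
by move: h1 h3; rewrite e; lra.
Qed.

End Geometry.

(** * The cut: climbing along the left frontier of a set closed to the right *)

Section Cut.
Variables (R : realType) (n : nat) (S : rectangulation R n) (N : pred 'I_n).
Implicit Types (A C W X Y Z : 'I_n) (L M : set (R * R)) (x y : R).
Local Notation D := (outer S).
Local Notation B := (rect S).
Local Notation vstep := (vstep S).
Local Notation hstep := (hstep S).
Hypothesis N_inner : forall Z, N Z -> xmin D < xmin (B Z).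
Hypothesis N_vstep : forall Z W, N Z -> vstep Z W -> N W.
Hypothesis N_hadj : forall A Z W, N Z -> hadj S A Z -> hadj S A W -> N W.

(* In the application N is the set of boxes having X or Y on their left. The  *)
(* boxes in cut form a chain for hstep from the bottom of D to its top.       *)
Definition cut A := ~~ N A /\ forall Z, hadj S A Z -> N Z.

Lemma N_connect Z W : N Z -> connect vstep Z W -> N W.
Proof.
move=> + /connectP[s]; elim: s Z => [|T s IH] Z NZ /=; first by move=> _ ->.
by move=> /andP[/(N_vstep NZ) NT] /(IH _ NT) h /h.
Qed.

Lemma walk_N y X Y : at_height S y X -> at_height S y Y ->
  xmax (B X) <= xmin (B Y) -> N X -> N Y.
Proof.
move=> yX yY /(walk_right yX yY)[Z [/hadj_vstep XZ _ ZY]] NX.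
exact: N_connect (N_vstep NX XZ) ZY.
Qed.

Lemma walk_cut y X Y : at_height S y X -> at_height S y Y ->
  xmax (B X) <= xmin (B Y) -> cut X -> N Y.
Proof.
move=> yX yY /(walk_right yX yY)[Z [XZ _ ZY]] [_ /(_ Z XZ) NZ].
exact: N_connect NZ ZY.
Qed.

Lemma cut_unique y A C : cut A -> cut C ->
  at_height S y A -> at_height S y C -> A = C.
Proof.
move=> cA cC yA yC; apply/eqP; apply: contraT => AC.
have [h|h] := at_height_sep yA yC AC.
  by have := walk_cut yA yC h cA; rewrite (negbTE cC.1).
by have := walk_cut yC yA h cC; rewrite (negbTE cA.1).
Qed.

(** Take the rightmost box at height [y] outside [N]; one exists by [N_inner]. If it has a right
    neighbour, the one at height [y] lies in [N], and [N_hadj] extends this to all of them. *)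
Lemma cut_at y : ymin D <= y < ymax D -> exists2 A, cut A & at_height S y A.
Proof.
move=> hy; have hD := box_wd D.
have [|Z0 /andP[h1 h2]] := @rect_cover _ _ S (xmin D) y _ hy; first lra.
have P0 : at_height S y Z0 && ~~ N Z0.
  by rewrite /at_height h2; apply/negP => /N_inner; lra.
case: (@arg_maxP _ _ _ Z0 (fun Z => at_height S y Z && ~~ N Z)
  (fun Z => xmin (B Z)) P0) => A /andP[yA nA] maxA.
exists A => //; split=> // Z AZ; have wA := box_wd (B A); have wZ := box_wd (B Z).
have [e _] := AZ; have [_ d _ _] := rect_sub_outer S Z.
have [|W yW eW] := right_neighbour yA; first lra.
have NW : N W.
  by apply: contraT => nW; have /= := maxA W; rewrite yW nW => /(_ isT); lra.
exact: N_hadj NW (at_height_hadj yA yW (esym eW)) AZ.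
Qed.

(** [W] crosses the level of the top of [A], so it can be compared with [A] under that level and
    with [C] at it. Membership in [N] decides the side of the cut in both comparisons, so the
    answers agree. *)
Lemma cut_straddle A C W : cut A -> cut C -> at_height S (ymax (B A)) C ->
  at_height S (ymax (B A)) W -> ymin (B W) < ymax (B A) ->
  (xmax (B A) <= xmin (B W) /\ xmax (B C) <= xmin (B W)) \/
  (xmax (B W) <= xmin (B A) /\ xmax (B W) <= xmin (B C)).
Proof.
move=> cA cC yC yW hW; have hA := box_ht (B A).
(* A height below the top of [A] at which both [A] and [W] are present. *)
pose y := Num.max (ymin (B A)) (ymin (B W)).
have y1 : y < ymax (B A) by rewrite gt_max hA.
have y2 : ymin (B A) <= y by rewrite le_max lexx.
have y3 : ymin (B W) <= y by rewrite le_max lexx orbT.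
have zA : at_height S y A by rewrite /at_height y1 y2.
have zW : at_height S y W by move: yW; rewrite /at_height; lra.
have AW : A != W by apply/eqP => e; move: yW; rewrite /at_height e; lra.
have [h|h] := at_height_sep zA zW AW; [left|right]; split=> //.
  have NW := walk_cut zA zW h cA.
  have CW : C != W by apply: contraTneq NW => <-; exact: cC.1.
  have [//|k] := at_height_sep yC yW CW.
  by have := walk_N yW yC k NW; rewrite (negbTE cC.1).
have NW : ~~ N W by apply: contra cA.1; exact: walk_N zW zA h.
have CW : C != W.
  by apply: contraNneq AW => e; apply/eqP; apply: (cut_unique cA _ zA zW); rewrite -e.
have [k|//] := at_height_sep yC yW CW.
by have := walk_cut yC yW k cC; rewrite (negbTE NW).
Qed.

Lemma cut_hstep A : cut A -> ymax (B A) < ymax D -> exists2 C, cut C & hstep A C.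
Proof.
move=> cA hA; have [dA1 dA2 dA3 dA4] := rect_sub_outer S A; have htA := box_ht (B A).
have wA := box_wd (B A).
have [|C cC yC] := @cut_at (ymax (B A)); first lra.
have [dC1 dC2 dC3 dC4] := rect_sub_outer S C; have htC := box_ht (B C).
have wC := box_wd (B C).
have eC : ymin (B C) = ymax (B A).
  apply/eqP; rewrite eq_le; move: (yC) => /andP[-> _] /=.
  rewrite leNgt; apply/negP => h.
  (* Taking [W] to be [C] would put [C] strictly beside itself. *)
  by have [[]|[]] := cut_straddle cA cC yC yC h; lra.
exists C => //.
pose c := Num.min (xmin (B A)) (xmin (B C)).
pose d := Num.max (xmax (B A)) (xmax (B C)).
have [c1 c2] : c <= xmin (B A) /\ c <= xmin (B C).
  by rewrite !ge_min !lexx orbT.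
have [d1 d2] : xmax (B A) <= d /\ xmax (B C) <= d.
  by rewrite !le_max !lexx orbT.
(* A segment at this level passing [c] cannot stop at [q] before [d]: the box at [q] either crosses
   the level, impossible between [c] and [d] by [cut_straddle], or rests on it, and then its bottom
   side is absorbed beyond [q]. *)
have reach L p q : segment D B L -> L = hseg (ymax (B A)) p q -> p <= c -> c < q -> d <= q.
  move=> sL eL pc cq; rewrite leNgt; apply/negP => qd.
  have dD : d <= xmax D by rewrite ge_max dA2 dC2.
  have cD : xmin D <= c by rewrite le_min dA1 dC1.
  have [||W /andP[xW yW]] := @rect_cover _ _ S q (ymax (B A)); try lra.
  have [h|h] := ltP (ymin (B W)) (ymax (B A)).
    have [[k1 k2]|[k1 k2]] := cut_straddle cA cC yC yW h.
      have : d <= xmin (B W) by rewrite ge_max k1.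
      lra.
    have : xmax (B W) <= c by rewrite le_min k1.
    lra.
  have eW : ymin (B W) = ymax (B A) by lra.
  have := side_bottom S W; rewrite /bottom_side eW => sW.
  have := @segment_absorb_h _ _ S L _ _ _ _ _ q sL eL sW.
  lra.
(* Start from whichever of the two sides begins at [c]. *)
have [h|h] := leP (xmin (B A)) (xmin (B C)).
  have ec : c = xmin (B A) by apply/min_idPl.
  have [|||L [p [q [sL eL h1 h2]]]] := hside_segment wA (side_top S A); try lra.
  have dq : d <= q by apply: reach sL eL _ _; lra.
  have := side_bottom S C; rewrite /bottom_side eC => sC.
  have := @segment_absorb_h _ _ S L _ _ _ _ _ (xmin (B C)) sL eL sC.
  by move=> k; apply/hstepP; exists L, p, q; split=> //; apply: k; lra.
have ec : c = xmin (B C) by apply/min_idPr/ltW.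
have [|||L [p [q [sL eL h1 h2]]]] := hside_segment wC (side_bottom S C); try lra.
rewrite eC in eL.
have dq : d <= q by apply: reach sL eL _ _; lra.
have sA := side_top S A.
have := @segment_absorb_h _ _ S L _ _ _ _ _ (xmin (B A)) sL eL sA.
by move=> k; apply/hstepP; exists L, p, q; split=> //; apply: k; lra.
Qed.

(** Climb by [cut_hstep] until the current box reaches the height of the bottom of [C]; there
    [cut_unique] identifies it with [C]. *)
Lemma cut_connect A C : cut A -> cut C -> ymin (B A) <= ymin (B C) ->
  connect hstep A C.
Proof.
have [m] := ubnP #|[set Z | ymin (B A) < ymin (B Z)]%SET|.
elim: m A => // m IH A hm cA cC AC.
have htA := box_ht (B A); have htC := box_ht (B C).
have [h|h] := ltP (ymin (B C)) (ymax (B A)).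
  by rewrite (@cut_unique (ymin (B C)) A C) // /at_height; lra.
have [_ _ _ dC] := rect_sub_outer S C.
have [|Z cZ AZ] := cut_hstep cA; first lra.
have /hstepP[_ [_ [_ [_ _ eZ _ _]]]] := AZ.
apply: connect_trans (connect1 AZ) _; apply: IH cZ cC _; last by rewrite -eZ.
rewrite ltnS in hm; apply: leq_trans hm; apply: proper_card; apply/properP; split.
  by apply/fintype.subsetP => T; rewrite !inE; lra.
by exists Z; rewrite !inE ?ltxx //; lra.
Qed.

End Cut.

(** * Exactly one of the four relations holds *)

Section Trichotomy.
Variables (R : realType) (n : nat) (S : rectangulation R n).
Implicit Types (A C W X Y Z : 'I_n) (L M : set (R * R)) (x y : R).
Local Notation D := (outer S).
Local Notation B := (rect S).
Local Notation vstep := (vstep S).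
Local Notation hstep := (hstep S).
Local Notation left_of := (left_of S).
Local Notation below := (below S).

Lemma vstep_left_of X Y : vstep X Y -> left_of X Y.
Proof.
move=> XY; rewrite /Defs.left_of connect1 // andbT; apply/eqP => e.
have /vstepP[_ [_ [_ [_ _ + _ _]]]] := XY; have := box_wd (B X); rewrite e; lra.
Qed.

Lemma left_of_hadj A X Y Z : left_of X Y -> hadj S A Y -> hadj S A Z -> left_of X Z.
Proof.
move=> /andP[XY /connectP[s sp eY]] AY AZ; move: sp eY XY.
case/lastP: s => [_ /= ->|s W]; first by rewrite eqxx.
rewrite rcons_path last_rcons => /andP[sp WY] eY XY; rewrite -eY in WY.
have /vstep_left_of WZ := vstep_right WY AY AZ.
have [->//|XW] := eqVneq X (last X s).
apply: left_of_trans WZ; rewrite /Defs.left_of XW; apply/connectP; by exists s.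
Qed.

(** Since neither box is left of the other, both lie outside [N] while their right neighbours lie in
    [N]: both are cut boxes. *)
Lemma left_or_below_total X Y : X != Y ->
  [|| left_of X Y, left_of Y X, below X Y | below Y X].
Proof.
move=> XY; case: (boolP (left_of X Y)) => //= nXY.
case: (boolP (left_of Y X)) => //= nYX.
pose N Z := left_of X Z || left_of Y Z.
have N1 Z : N Z -> xmin D < xmin (B Z).
  have [dX _ _ _] := rect_sub_outer S X; have [dY _ _ _] := rect_sub_outer S Y.
  by have := (box_wd (B X), box_wd (B Y)) => -[w1 w2] /orP[] /left_of_le; lra.
have N2 Z W : N Z -> vstep Z W -> N W.
  by move=> NZ /vstep_left_of ZW; apply/orP;
     case/orP: NZ => h; [left|right]; apply: left_of_trans h ZW.
have N3 A Z W : N Z -> hadj S A Z -> hadj S A W -> N W.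
  by move=> NZ AZ AW; apply/orP;
     case/orP: NZ => h; [left|right]; apply: left_of_hadj h AZ AW.
have cX : cut S N X.
  split; first by rewrite /N /Defs.left_of eqxx /=.
  by move=> Z /hadj_vstep/vstep_left_of h; rewrite /N h.
have cY : cut S N Y.
  split; first by rewrite /N [left_of Y Y]/Defs.left_of eqxx orbF.
  by move=> Z /hadj_vstep/vstep_left_of h; rewrite /N h orbT.
rewrite /Defs.below XY eq_sym XY /=.
have [h|/ltW h] := leP (ymin (B X)) (ymin (B Y)).
  by rewrite (cut_connect N1 N2 N3 cX cY h).
by rewrite (cut_connect N1 N2 N3 cY cX h) orbT.
Qed.

Lemma path_vstep_sorted X s Z : path vstep X s -> Z \in s ->
  xmax (B X) <= xmin (B Z).
Proof.
elim: s X => //= Y s IH X /andP[XY sp]; rewrite in_cons => /orP[/eqP->|Zs].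
  by have /vstepP[_ [_ [_ [_ _ e _ _]]]] := XY; rewrite e.
have := IH _ sp Zs; have := box_wd (B Y).
by have /vstepP[_ [_ [_ [_ _ e _ _]]]] := XY; lra.
Qed.

Lemma side_not_int s p Z : sides B s -> s p -> ~ box_int (B Z) p.
Proof.
move=> [W Ws] sp; rewrite box_intE => pZ.
have hW := (box_wd (B W), box_ht (B W)).
have pW : (xmin (B W) <= p.1 <= xmax (B W)) && (ymin (B W) <= p.2 <= ymax (B W)).
  by case: Ws sp => ->; rewrite /left_side /right_side /bottom_side /top_side
    ?vsegE ?hsegE => /andP[/eqP->]; case: hW; lra.
have [e|WZ] := eqVneq W Z; last by have [] := rect_sep S WZ; lra.
rewrite -e in pZ; case: Ws sp => ->;
by rewrite /left_side /right_side /bottom_side /top_side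
    ?vsegE ?hsegE => /andP[/eqP e']; rewrite e' in pZ; lra.
Qed.

Lemma hseg_side L y c d Z : segment D B L -> L = hseg y c d ->
  c < xmax (B Z) -> xmin (B Z) < d -> c < d ->
  ymax (B Z) <= y \/ y <= ymin (B Z).
Proof.
move=> [[_ [F FS eF] _] _] eL cZ Zd cd.
have [?|h1] := leP (ymax (B Z)) y; first by left.
have [?|h2] := leP y (ymin (B Z)); first by right.
exfalso; have wZ := box_wd (B Z).
have [|x [cx Zx xZ xd]] := @exists_between _ c (xmin (B Z)) (xmax (B Z)) d.
  by rewrite cZ cd wZ Zd.
have : L (x, y) by rewrite eL hsegE /= eqxx; lra.
rewrite eF => -[s Fs sp]; apply: (side_not_int (FS _ Fs) sp (Z := Z)).
by rewrite box_intE /=; lra.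
Qed.

(* The only use of genericity: a horizontal segment passing from one side of  *)
(* the chain to the other would cross the vertical segment between two        *)
(* consecutive boxes of the chain.                                            *)
Lemma path_above X s Z L y c d : path vstep X s -> Z \in X :: s ->
  segment D B L -> L = hseg y c d -> c < d ->
  c < xmax (B X) -> xmin (B Z) < d -> (ymax (B X) <= y) = (ymax (B Z) <= y).
Proof.
move=> + + sL eL cd; elim: s X => [|Y s IH] X.
  by rewrite inE => _ /eqP->.
rewrite in_cons /= => /andP[XY sp] /orP[/eqP->//|Zs] cX Zd.
have /vstepP[M [a [b [sM eM e [a1 b1] [a2 b2]]]]] := XY.
have wX := box_wd (B X); have wY := box_wd (B Y).
have hX := box_ht (B X); have hY := box_ht (B Y).
have Yd : xmin (B Y) < d.
  move: Zs; rewrite in_cons => /orP[/eqP<-//|Zs].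
  by have := path_vstep_sorted sp Zs; lra.
rewrite -(IH Y) //; last lra.
have ncross : ~~ (a < y < b).
  apply/negP => yab; apply: (rect_generic sM sL).
  by exists (xmax (B X)), a, b, y, c, d; split=> //; lra.
have Xy : ymax (B X) <= y \/ y <= ymin (B X) by apply: (hseg_side sL eL); lra.
have Yy : ymax (B Y) <= y \/ y <= ymin (B Y) by apply: (hseg_side sL eL); lra.
have {ncross} : y <= a \/ b <= y by case: (leP y a) ncross => //=; rewrite -?leNgt; auto.
by move=> ncross; apply/idP/idP; case: Xy; case: Yy; case: ncross; lra.
Qed.

Lemma left_end X : exists2 Z, connect vstep Z X & xmin (B Z) = xmin D.
Proof.
have [d1 d2 d3 d4] := rect_sub_outer S X.
have w := box_wd (B X); have h := box_ht (B X).
have [||Z /andP[hx hy]] := @rect_cover _ _ S (xmin D) (ymin (B X)); try lra.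
have [dZ _ _ _] := rect_sub_outer S Z.
exists Z; last lra.
have [->//|ZX] := eqVneq Z X.
have yX : at_height S (ymin (B X)) X by rewrite /at_height; lra.
have [k|k] := at_height_sep hy yX ZX; last lra.
have [W [/hadj_vstep ZW _ WX]] := walk_right hy yX k.
exact: connect_trans (connect1 ZW) WX.
Qed.

Lemma right_end X : exists2 Z, connect vstep X Z & xmax (B Z) = xmax D.
Proof.
have yX : at_height S (ymin (B X)) X by rewrite /at_height lexx box_ht.
have P0 : connect vstep X X && at_height S (ymin (B X)) X by rewrite connect0.
case: (@arg_maxP _ _ _ X (fun Z => connect vstep X Z && at_height S (ymin (B X)) Z)
  (fun Z => xmin (B Z)) P0) => Z /andP[XZ yZ] maxZ.
exists Z => //; apply/eqP; rewrite eq_le.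
have [_ -> _ _] := rect_sub_outer S Z; rewrite leNgt; apply/negP => h.
have [W yW eW] := right_neighbour yZ h; have wZ := box_wd (B Z).
have XW : connect vstep X W.
  apply: connect_trans XZ (connect1 _).
  exact: hadj_vstep (at_height_hadj yZ yW (esym eW)).
by have /= := maxZ W; rewrite yW XW => /(_ isT); lra.
Qed.

Lemma path_cover X s x : path vstep X s -> xmin (B X) <= x < xmax (B (last X s)) ->
  exists2 Z, Z \in X :: s & xmin (B Z) <= x < xmax (B Z).
Proof.
elim: s X => [|Y s IH] X /=; first by exists X; rewrite ?inE.
move=> /andP[/vstepP[_ [_ [_ [_ _ e _ _]]]] sp] /andP[h1 h2].
have [h|h] := ltP x (xmax (B X)); first by exists X; rewrite ?inE ?eqxx ?h1.
have [|Z Zs hZ] := IH Y sp; first by rewrite -e h.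
by exists Z; rewrite // in_cons Zs orbT.
Qed.

Definition xmeet Z W := xmin (B Z) < xmax (B W) /\ xmin (B W) < xmax (B Z).

Lemma path_xmeet X s Z W : path vstep X s -> Z \in X :: s -> W \in X :: s ->
  xmeet Z W -> Z = W.
Proof.
elim: s X => [|Y s IH] X; first by rewrite !inE => _ /eqP-> /eqP->.
move=> sp; have so (T : 'I_n) : T \in Y :: s -> xmax (B X) <= xmin (B T).
  exact: path_vstep_sorted sp.
move: sp => /= /andP[_ sp].
rewrite !(in_cons X) => /orP[/eqP->|Zs] /orP[/eqP->|Ws] // [h1 h2].
- by move: h2 => {h1}; rewrite ltNge (so _ Ws).
- by move: h1 => {h2}; rewrite ltNge (so _ Zs).
- by apply: (IH Y).
Qed.

Lemma path_same_side X s Z W L y c d : path vstep X s ->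
  Z \in X :: s -> W \in X :: s ->
  segment D B L -> L = hseg y c d -> c < d ->
  c < xmax (B Z) -> xmin (B Z) < d -> c < xmax (B W) -> xmin (B W) < d ->
  ymax (B Z) <= y -> ymax (B W) <= y.
Proof.
move=> + + + sL eL cd; elim: s X => [|Y s IH] X.
  by rewrite !inE => _ /eqP-> /eqP->.
move=> sp; rewrite !(in_cons X) => /orP[/eqP->|Zs] /orP[/eqP->|Ws] // h1 h2 h3 h4.
- by rewrite (path_above sp _ sL eL cd h1 h4) // in_cons Ws orbT.
- by rewrite (path_above sp _ sL eL cd h3 h2) // in_cons Zs orbT.
- by move: sp => /= /andP[_ sp]; apply: (IH Y).
Qed.

(** Going up from [A], every chain box over or under the current box stays below it. At [C] this
    would put [C] below its own bottom. *)
Lemma connect_not_below X s A C : path vstep X s -> xmin (B X) = xmin D ->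
  xmax (B (last X s)) = xmax D -> A \in X :: s -> C \in X :: s -> ~~ below A C.
Proof.
move=> sp e1 e2 As Cs; apply/negP => /andP[AC /connectP[t tp eC]].
pose P W h := forall Z, Z \in X :: s -> xmeet W Z -> ymax (B Z) <= h.
have step W T : P W (ymax (B W)) -> hstep W T -> P T (ymin (B T)).
  move=> PW /hstepP[L [c [d [sL eL <- [c1 d1] [c2 d2]]]]] Z Zs [m1 m2].
  have wW := box_wd (B W); have wT := box_wd (B T).
  have [dW1 dW2 _ _] := rect_sub_outer S W.
  (* The chain spans [D], so some [V] in it meets the x-range of [W]; the bound on [V] passes to [Z]
     along the common segment. *)
  have [|V Vs hV] := @path_cover X s (xmin (B W)) sp; first by rewrite e1 e2; lra.
  apply: (path_same_side (Z := V) sp Vs Zs sL eL); try lra.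
  by apply: PW => //; split; lra.
have PA : P A (ymax (B A)) by move=> Z Zs /(path_xmeet sp As Zs) <-.
have CC : xmeet C C by split; exact: box_wd.
suff : P C (ymin (B C)) by move=> /(_ C Cs CC); have := box_ht (B C); lra.
case: t tp eC AC => [|T t] /=; first by move=> _ ->; rewrite eqxx.
move=> /andP[/(step _ _ PA) PT tp] -> _.
elim: t T tp PT => //= V t IH T /andP[TV tp] PT; apply: IH tp _.
apply: step TV => Z Zs /(PT Z Zs); have := box_ht (B T); lra.
Qed.

Lemma left_not_below X Y : left_of X Y -> ~~ below X Y && ~~ below Y X.
Proof.
move=> /andP[_ /connectP[s sp eY]].
have [Z /connectP[s1 p1 eX] eZ] := left_end X.
have [W /connectP[s2 p2 eW] eW'] := right_end Y.
have p : path vstep Z (s1 ++ s ++ s2) by rewrite !cat_path -eX -eY p1 sp.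
have l : xmax (B (last Z (s1 ++ s ++ s2))) = xmax D.
  by rewrite !last_cat -eX -eY -eW.
have Xs : X \in Z :: s1 ++ s ++ s2.
  by rewrite -cat_cons mem_cat {1}eX mem_last.
have Ys : Y \in Z :: s1 ++ s ++ s2.
  by rewrite catA -cat_cons mem_cat {1}eY eX -last_cat mem_last.
by rewrite !(connect_not_below p eZ l).
Qed.

End Trichotomy.

(** * Positions in a linear order, and their transport *)

Section Listing.
Variables (n : nat) (r : rel 'I_n).
Hypotheses (r_irr : irreflexive r) (r_trans : transitive r).
Hypothesis r_total : forall X Y, X != Y -> r X Y || r Y X.
Local Notation le := (fun X Y => (X == Y) || r X Y).

Lemma listing_le_trans : transitive le.
Proof.
move=> Y X Z /orP[/eqP->//|XY] /orP[/eqP<-|YZ]; first by rewrite XY orbT.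
by rewrite (r_trans XY YZ) orbT.
Qed.

Lemma listing_le_anti : antisymmetric le.
Proof.
move=> X Y /andP[/orP[/eqP//|XY] /orP[/eqP//|YX]].
by have := r_trans XY YX; rewrite r_irr.
Qed.

Lemma listing_le_total : total le.
Proof. by move=> X Y; rewrite (eq_sym Y); case: eqVneq => //= /r_total. Qed.

Lemma listing_sorted : sorted le (listing r).
Proof. exact: (sort_sorted listing_le_total). Qed.

Lemma position_lt X Y : (position r X < position r Y)%N = r X Y.
Proof.
have lt_r Z W : (position r Z < position r W)%N -> r Z W.
  move=> ZW; have nZW : Z != W by apply: contraTneq ZW => ->; rewrite ltnn.
  have := sorted_ltn_nth listing_le_trans Z listing_sorted _ _ _ _ ZW.
  rewrite !inE !index_mem !nth_index ?mem_listing // (negbTE nZW) /=.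
  exact.
apply/idP/idP => [/lt_r//|XY].
case: (ltngtP (position r X) (position r Y)) => // [/lt_r YX|].
  by have := r_trans XY YX; rewrite r_irr.
move=> /(congr1 (nth X (listing r))); rewrite !nth_index ?mem_listing // => e.
by rewrite e r_irr in XY.
Qed.

Lemma position_rect_at j : position r (rect_at r j) = j.
Proof.
by apply/val_inj; rewrite /= index_uniq ?size_listing ?uniq_listing.
Qed.

End Listing.

(** Both lists enumerate all labels in increasing order for [r'], and such an enumeration is
    unique. *)
Lemma rect_at_transport n (r r' : rel 'I_n) (f : 'I_n -> 'I_n) j :
  irreflexive r' -> transitive r' -> (forall X Y, X != Y -> r' X Y || r' Y X) ->
  bijective f -> (forall X Y, r' (f X) (f Y) = r X Y) ->
  rect_at r' j = f (rect_at r j).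
Proof.
move=> irr tr tot bf fr; have fI := bij_inj bf.
have r_irr : irreflexive r by move=> X; rewrite -fr.
have r_tr : transitive r by move=> Y X Z; rewrite -!fr; apply: tr.
have r_tot X Y : X != Y -> r X Y || r Y X.
  by rewrite -!fr => XY; apply: tot; rewrite (inj_eq fI).
suff -> : rect_at r' j = nth (f j) (map f (listing r)) j.
  by rewrite (nth_map j) ?size_listing.
suff e : listing r' = map f (listing r).
  by rewrite -e /rect_at; apply: set_nth_default; rewrite size_listing.
apply: (sorted_eq (listing_le_trans tr) (listing_le_anti irr tr)) => //.
- exact: listing_sorted.
- rewrite sorted_map; apply: sub_sorted (listing_sorted r_tot) => X Y /=.
  by rewrite fr (inj_eq fI).
- apply: uniq_perm; rewrite ?map_inj_uniq ?uniq_listing // => X.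
  by have [g _ gK] := bf; rewrite mem_listing -(gK X) map_f ?mem_listing.
Qed.

(** * Union of two mutually exclusive partial orders *)

Section UnionOfOrders.
Variables (T : eqType) (l b : rel T).
Hypotheses (l_irr : irreflexive l) (l_trans : transitive l).
Hypotheses (b_irr : irreflexive b) (b_trans : transitive b).
Hypothesis l_not_b : forall X Y, l X Y -> ~~ b X Y && ~~ b Y X.
Hypothesis lb_total : forall X Y, X != Y -> [|| l X Y, l Y X, b X Y | b Y X].
(** Both [swne] and [senw] have this form, with [l] being [left_of] or [right_of]. *)
Definition union_rel : rel T := fun X Y => l X Y || b X Y.
Local Notation r := union_rel.

Lemma union_rel_irr : irreflexive r.
Proof. by move=> X; rewrite /r l_irr b_irr. Qed.

Lemma union_rel_total X Y : X != Y -> r X Y || r Y X.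
Proof. by rewrite /r => /lb_total/or4P[] ->; rewrite ?orbT. Qed.

Lemma union_rel_asym X Y : r X Y -> ~~ r Y X.
Proof.
rewrite /r negb_or => /orP[lXY|bXY]; apply/andP; split.
- by apply/negP => /(l_trans lXY); rewrite l_irr.
- by have /andP[] := l_not_b lXY.
- by apply: contraL bXY => /l_not_b/andP[].
- by apply/negP => /(b_trans bXY); rewrite b_irr.
Qed.

(* In a cycle of three, two consecutive relations are of the same kind, and   *)
(* their composition contradicts the third.                                   *)
Lemma union_rel_trans : transitive r.
Proof.
move=> Y X Z XY YZ; have [e|XZ] := eqVneq X Z.
  by move: (union_rel_asym XY); rewrite e YZ.
have /orP[//|ZX] := union_rel_total XZ.
have lcyc P Q O : l P Q -> l Q O -> ~~ r O P.
  by move=> PQ /(l_trans PQ) PO; apply: union_rel_asym; rewrite /r PO.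
have bcyc P Q O : b P Q -> b Q O -> ~~ r O P.
  by move=> PQ /(b_trans PQ) PO; apply: union_rel_asym; rewrite /r PO orbT.
have /orP[lXY|bXY] := XY; have /orP[lYZ|bYZ] := YZ; have /orP[lZX|bZX] := ZX.
- by have := lcyc _ _ _ lXY lYZ; rewrite ZX.
- by have := lcyc _ _ _ lXY lYZ; rewrite ZX.
- by have := lcyc _ _ _ lZX lXY; rewrite YZ.
- by have := bcyc _ _ _ bYZ bZX; rewrite XY.
- by have := lcyc _ _ _ lYZ lZX; rewrite XY.
- by have := bcyc _ _ _ bZX bXY; rewrite YZ.
- by have := bcyc _ _ _ bXY bYZ; rewrite ZX.
- by have := bcyc _ _ _ bXY bYZ; rewrite ZX.
Qed.

End UnionOfOrders.

(** * The two linear orders and the identity *)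

Section Orders.
Variables (R : realType) (n : nat) (S : rectangulation R n).
Implicit Types X Y Z : 'I_n.

Lemma left_of_irr : irreflexive (left_of S).
Proof. by move=> X; rewrite /left_of eqxx. Qed.

Lemma below_irr : irreflexive (below S).
Proof. by move=> X; rewrite /below eqxx. Qed.

Lemma right_of_trans : transitive (right_of S).
Proof. by move=> Y X Z XY YZ; exact: left_of_trans YZ XY. Qed.

Lemma right_not_below X Y : right_of S X Y -> ~~ below S X Y && ~~ below S Y X.
Proof. by move=> /left_not_below; rewrite andbC. Qed.

Lemma right_or_below_total X Y : X != Y ->
  [|| right_of S X Y, right_of S Y X, below S X Y | below S Y X].
Proof. by rewrite orbCA; exact: left_or_below_total. Qed.

Lemma swne_irr : irreflexive (swne S).
Proof. exact: union_rel_irr left_of_irr below_irr. Qed.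

Lemma swne_total X Y : X != Y -> swne S X Y || swne S Y X.
Proof. exact: union_rel_total (left_or_below_total S) X Y. Qed.

Lemma swne_trans : transitive (swne S).
Proof.
exact (union_rel_trans left_of_irr (@left_of_trans _ _ S) below_irr
  (@below_trans _ _ S) (@left_not_below _ _ S) (@left_or_below_total _ _ S)).
Qed.

Lemma senw_irr : irreflexive (senw S).
Proof. exact: union_rel_irr left_of_irr below_irr. Qed.

Lemma senw_total X Y : X != Y -> senw S X Y || senw S Y X.
Proof. exact: union_rel_total right_or_below_total X Y. Qed.

Lemma senw_trans : transitive (senw S).
Proof.
exact (@union_rel_trans _ (right_of S) (below S) left_of_irr right_of_trans below_irr
  (@below_trans _ _ S) right_not_below right_or_below_total).
Qed.

Lemma tau_Theta_beta : tau S = Theta (beta S).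
Proof.
apply: eq_from_tnth => k; rewrite !tnth_mktuple.
have inj : injective (rect_at (swne S)).
  exact: can_inj (position_rect_at _).
(* Count the boxes to the left by their [swne] positions [i]. *)
rewrite -(card_preimset _ inj); apply: eq_card => i; rewrite !inE !permE.
rewrite (position_lt senw_irr senw_trans senw_total).
rewrite -{2}(position_rect_at (swne S) i) -{2}(position_rect_at (swne S) k).
rewrite (position_lt swne_irr swne_trans swne_total).
set X := rect_at _ i; set Y := rect_at _ k.
rewrite /swne /senw /right_of; case: (boolP (left_of S X Y)) => //= nXY.
(* If [X] is not left of [Y], an inversion would make each of them below the other. *)
by apply/esym/negP => /andP[XY /(below_trans XY)]; rewrite below_irr.
Qed.

End Orders.

Lemma tau_weakly_equivalent (R : realType) (n : nat) (S T : rectangulation R n) :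
  weakly_equivalent S T -> tau S = tau T.
Proof.
move=> [f bf fST]; apply: eq_from_tnth => k; rewrite !tnth_mktuple.
have fI := bij_inj bf.
rewrite (rect_at_transport (r := swne S) k (@swne_irr _ _ T) (@swne_trans _ _ T)
  (@swne_total _ _ T) bf); last first.
  by move=> X Y; rewrite /swne; have [-> _ -> _] := fST X Y.
rewrite -[RHS](card_preimset _ fI); apply: eq_card => X; rewrite !inE.
by have [-> _ _ _] := fST X (rect_at (swne S) k).
Qed.

(** The representatives [S] and [T] vary independently, so independence of their choice is part of
    the claim. *)
Theorem theorem3 (R : realType) (n : nat) (W : weak_rectangulation R n)
    (S T : rectangulation R n) (SW : members W S) (TW : members W T) :
  tau S = Theta (beta T).
Proof.
have [S0 e] := members_class W; rewrite e /= in SW TW.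
by rewrite -(tau_weakly_equivalent SW) (tau_weakly_equivalent TW) tau_Theta_beta.
Qed.
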